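(* Let $f:X\to\mathbb R$ be a continuous function and let $r\in\mathbb R$. The following are equivalent: (i) The Lebesgue integral of $f$ with respect to the normalised Borel measure $\mu$ satisfies $\int f\,d\mu=r$. (ii) For each $\epsilon>0$ there exist a partition $P$ of $X$ and real numbers $\alpha,\beta$ with $0<\alpha<1$ and $0<\beta<1$ such that $r\in\int f\,d\mu_{P,\alpha,\beta}$ and $\operatorname{diam}\left(\int f\,d\mu_{P,\alpha,\beta}\right)<\epsilon$. (iii) For each $\epsilon>0$ there exists a gauge $\gamma$ on $X$ such that $\left|\int f\,d\mu_{\dot P,\gamma}-r\right|<\epsilon$ for every $\gamma$-fine tagged partition $\dot P$ of $X$.
   Context: $X$ is a compact metric space with metric $d$, $O_r(x)$ is the open ball of radius $r$ about $x$, and $\mu$ is a normalised Borel measure on $X$ (i.e. $\mu(X)=1$). Let $\mathcal B$ be a basis of open subsets of $X$ containing $\emptyset$ and closed under finite intersections (including the empty intersection, so $X\in\mathcal B$), and put $\mathbf C_{\mathcal B}=\{A_1\cap A_2^c: A_1,A_2\in\mathcal B\}$; its elements are called crescents. $\mathbf C_{\mathcal B}$ is partitionable if it is closed under finite intersections and, for all $C,C_0\in\mathbf C_{\mathcal B}$, the set $C\setminus C_0$ is a finite union of pairwise disjoint elements of $\mathbf C_{\mathcal B}$. Throughout, $\mathcal B$ is fixed with $\mathbf C_{\mathcal B}$ partitionable. A partition of $C\in\mathbf C_{\mathcal B}$ is a finite set of pairwise disjoint non-empty crescents in $\mathbf C_{\mathcal B}$ with union $C$. A gauge on $X$ is a function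 $\gamma:X\to\mathbb R$ with $\gamma(x)>0$ for all $x$. A tagged partition of $X$ is a finite set $\dot P=\{(R_i,t_i):1\le i\le n\}$ where $P=\{R_i:1\le i\le n\}$ is a partition of $X$ and $t_i\in\overline{R_i}$; it is $\gamma$-fine if $\overline{R_i}\subset O_{\gamma(t_i)}(t_i)$ for all $i$. For a $\gamma$-fine tagged partition, $\mu_{\dot P,\gamma}=\sum_i\mu(R_i)\delta_{t_i}$, so $\int f\,d\mu_{\dot P,\gamma}=\sum_i f(t_i)\mu(R_i)$. For compact $K\subset X$ and $\alpha>0$, $K_\alpha=\{x\in X:\exists y\in K,\ d(x,y)\le\alpha\}$. For a partition $P=\{R_i:1\le i\le n\}$ of $X$ and $\alpha>0$, $0<\beta<1$, define the formal convex combinations of point masses on non-empty compact subsets of $X$ $$\mu_{P,\alpha}=\sum_{i=1}^n\mu(R_i)\,\delta_{(\overline{R_i})_\alpha},\qquad \mu_{P,\alpha,\beta}=\beta\,\delta_X+(1-\beta)\,\mu_{P,\alpha}.$$ For $\nu=\sum_j r_j\delta_{K_j}$ with $r_j\ge0$ and $K_j\subset X$ non-empty compact, $\int f\,d\nu$ denotes the compact interval $[S^\ell(f,\nu),S^u(f,\nu)]$, where $S^\ell(f,\nu)=\sum_j r_j\inf f[K_j]$ and $S^u(f,\nu)=\sum_j r_j\sup f[K_j]$. *)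

(* Defs.v *)
From HB Require Import structures.
From mathcomp Require Import all_boot all_order all_algebra.
From mathcomp Require Import all_classical all_reals all_analysis.

Set Implicit Arguments.
Unset Strict Implicit.
Unset Printing Implicit Defensive.

Import Order.TTheory GRing.Theory Num.Theory.
Import numFieldNormedType.Exports.

Local Open Scope classical_set_scope.
Local Open Scope ring_scope.

(* The library only builds measurable types over pointed types, and metricType
   is not pointed. A space carrying a normalised measure is non-empty. *)
#[short(type="pointedMetricType")]
HB.structure Definition PointedMetric (K : numDomainType) :=
  { M of PseudoPointedMetric K M & PseudoMetric_isMetric K M }.

(* The Borel sigma-algebra: generated by the open sets. *)
Notation borelType X := (g_sigma_algebraType (@open X)).

Section crescents.
Context {R : realType} {X : pointedMetricType R}.
Implicit Types (B : set (set X)) (C : set X) (n : nat).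

(* The third conjunct is closure under the empty intersection. *)
Definition closed_basis B :=
  [/\ basis B, B set0, B [set: X] & setI_closed B].

Definition crescents B : set (set X) :=
  [set A1 `&` ~` A2 | A1 in B & A2 in B].

Definition partitionable (G : set (set X)) :=
  setI_closed G /\ semi_setD_closed G.

(* A partition {R_1, ..., R_n} is given by a family indexed by 'I_n; being
   pairwise disjoint and non-empty, its members are automatically distinct. *)
Definition crescent_partition B C n (P : 'I_n -> set X) :=
  (forall i, crescents B (P i)) /\ partition [set: 'I_n] P C.

Definition gauge (gamma : X -> R) := forall x, 0 < gamma x.

Definition tagged_partition B n (P : 'I_n -> set X) (t : 'I_n -> X) :=
  crescent_partition B [set: X] P /\ forall i, closure (P i) (t i).

Definition gauge_fine (gamma : X -> R) n (P : 'I_n -> set X) (t : 'I_n -> X) :=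
  forall i, closure (P i) `<=` [set y | mdist (t i) y < gamma (t i)].

(* The integral of f against the simple valuation sum_i mu(P i) delta_(t i). *)
Definition tagged_integral (mu : probability (borelType X) R) (f : X -> R)
    n (P : 'I_n -> set X) (t : 'I_n -> X) : R :=
  \sum_(i < n) f (t i) * fine (mu (P i)).

Definition thickening (K : set X) (alpha : R) : set X :=
  [set x | exists2 y, K y & mdist x y <= alpha].

(* sum_j r_j delta_(K_j) is represented by the sequence of the (r_j, K_j). *)
Definition formal_comb := seq (R * set X).

Definition partition_comb (mu : probability (borelType X) R)
    n (P : 'I_n -> set X) (alpha : R) : formal_comb :=
  [seq (fine (mu (P i)), thickening (closure (P i)) alpha) | i : 'I_n].

Definition mixed_partition_comb (mu : probability (borelType X) R)
    n (P : 'I_n -> set X) (alpha beta : R) : formal_comb :=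
  (beta, [set: X]) ::
    [seq ((1 - beta) * p.1, p.2) | p <- partition_comb mu P alpha].

Definition lower_sum (f : X -> R) (nu : formal_comb) : R :=
  \sum_(p <- nu) p.1 * inf (f @` p.2).

Definition upper_sum (f : X -> R) (nu : formal_comb) : R :=
  \sum_(p <- nu) p.1 * sup (f @` p.2).

Definition comb_integral (f : X -> R) (nu : formal_comb) : set R :=
  `[lower_sum f nu, upper_sum f nu]%classic.

End crescents.

Definition diam {R : realType} (A : set R) : R :=
  sup [set `|x - y| | x in A & y in A].

(* Main.v *)
(* Uniform continuity makes f almost constant on the slightly thickened closures
   of the members of a fine enough partition of X into crescents, so that both
   the interval of (ii) and the tagged sums of (iii) pin down the Lebesgue
   integral, which always lies in the interval. Conversely, (iii) speaks about
   arbitrary gauges and needs Cousin's lemma: every gauge admits a fine tagged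
   partition. Otherwise X has a sequence of nested, ever smaller crescents none
   of which can be split into fine tagged pieces; by compactness their closures
   share a point t, and the crescents of diameter below gamma(t) are fine when
   tagged by t, a contradiction. *)
Require Import Defs.
From mathcomp Require Import all_boot all_order all_algebra.
From mathcomp Require Import all_classical all_reals all_analysis.
From mathcomp Require Import ring lra.

Set Implicit Arguments.
Unset Strict Implicit.
Unset Printing Implicit Defensive.

Import Order.TTheory GRing.Theory Num.Theory.
Import numFieldNormedType.Exports.

Local Open Scope classical_set_scope.
Local Open Scope ring_scope.


(** * Uniform continuity and integrability of continuous functions on a compact space *)

Section oscillation.
Context {R : realType} {X : pointedMetricType R}.
Implicit Types (f : X -> R) (A : set X).

(** A bound on pairwise distances rather than on a supremum: it holds for the empty set and passes
    to subsets. *)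
Definition diam_lt (delta : R) : set (set X) :=
  [set A | forall x y, A x -> A y -> mdist x y < delta].

Lemma diam_lt_sub delta A A' : A `<=` A' -> diam_lt delta A' -> diam_lt delta A.
Proof. by move=> AA' dA' x y /AA' A'x /AA' A'y; exact: dA'. Qed.

Lemma closure_mdist_lt A x e : 0 < e -> closure A x ->
  exists2 y, A y & mdist x y < e.
Proof.
move=> e0 /(_ _ (nbhsx_ballx x _ e0))[y [Ay]].
by rewrite ballEmdist/=; exists y.
Qed.

Lemma closure_diam_le delta A x y : diam_lt delta A ->
  closure A x -> closure A y -> mdist x y <= delta.
Proof.
move=> dA Ax Ay; apply/ler_addgt0Pr => e e0.
have e20 : 0 < e / 2 by rewrite divr_gt0.
have [x' Ax' xx'] := closure_mdist_lt e20 Ax.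
have [y' Ay' yy'] := closure_mdist_lt e20 Ay.
have := metric_triangle x x' y; have := metric_triangle x' y' y.
rewrite (metric_sym y' y); have := dA _ _ Ax' Ay'; lra.
Qed.

(** Heine-Cantor, through the near-covering form of compactness: small positive [delta] work locally
    around each point, hence everywhere at once. *)
Lemma compact_oscillation f e : compact [set: X] -> continuous f -> 0 < e ->
  exists2 delta : R, 0 < delta &
    forall x y, mdist x y < delta -> `|f x - f y| < e.
Proof.
move=> /compact_near_coveringP cX cf e0.
have := cX R 0^'+
  (fun delta x => forall y, mdist x y < delta -> `|f x - f y| < e) _.
case=> [x _|d /= d0 dP]; last first.
  have d20 : 0 < d / 2 by rewrite divr_gt0.
  exists (d / 2) => // x; apply: dP => //=.
  by rewrite sub0r normrN gtr0_norm//; lra.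
have /cvgrPdist_lt/(_ (e / 2)) := cf x.
rewrite divr_gt0// => /(_ isT)/nbhs_ballP[d /= d0 dP].
(* Half of the radius goes to [z] and half to [delta], so that [y] stays within [d] of [x]. *)
exists (ball x (d / 2), [set delta | 0 < delta < d / 2]).
  split => /=; first by apply: nbhsx_ballx; rewrite divr_gt0.
  near=> t; apply/andP; split => //.
  by near: t; apply: nbhs_right_lt; rewrite divr_gt0.
move=> [z t] [/= xz /andP[t0 td]] y zy.
have fz : `|f x - f z| < e / 2.
  by apply: dP; apply: le_ball xz; lra.
have fy : `|f x - f y| < e / 2.
  apply: dP; move: xz; rewrite !ballEmdist/= => xz.
  by have := metric_triangle x z y; lra.
by rewrite (le_lt_trans (ler_distD (f x) _ _))// distrC; lra.
Unshelve. all: by end_near. Qed.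

Lemma compact_bounded_image f : compact [set: X] -> continuous f ->
  exists M : R, forall x, `|f x| <= M.
Proof.
move=> cX cf.
have /compact_bounded[M [_ MP]] : compact (f @` [set: X]).
  by apply: continuous_compact => //; exact: continuous_subspaceT.
exists (M + 1) => x; apply: (MP (M + 1)); first by rewrite ltrDl.
by exists x.
Qed.

Lemma continuous_borel_measurable f : continuous f ->
  measurable_fun [set: borelType X] (f : borelType X -> R).
Proof.
move=> /continuousP cf.
apply: (measurability _ (measurable_realfun.RGenOpens.measurableE R)).
move=> _ [_ [a [b ->] <-]]; rewrite setTI.
by apply: sub_sigma_algebra; exact/cf/interval_open.
Qed.

Lemma continuous_integrable (mu : probability (borelType X) R) f :
  compact [set: X] -> continuous f ->
  mu.-integrable [set: borelType X] (EFin \o f).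
Proof.
move=> cX cf; apply: measurable_bounded_integrable => //.
- by rewrite [ltLHS]probability_setT ltry.
- exact: continuous_borel_measurable.
- have [M fM] := compact_bounded_image cX cf.
  exists M; split; first by rewrite num_real.
  by move=> N MN x _ /=; rewrite (le_trans (fM x)) ?ltW.
Qed.

End oscillation.

(** * Integrals over a finite measurable partition *)

Section partition_integral.
Context d {T : measurableType d} {R : realType} (mu : probability T R).
Variables (n : nat) (P : 'I_n -> set T).
Hypothesis mP : forall i, measurable (P i).
Hypothesis partP : partition [set: 'I_n] P [set: T].

Lemma Rintegral_partition (f : T -> R) : mu.-integrable [set: T] (EFin \o f) ->
  \int[mu]_x f x = \sum_(i < n) \int[mu]_(x in P i) f x.
Proof.
move=> intf; have [covP tP _] := partP.
have UP : \big[setU/set0]_(i < n) P i = [set: T].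
  rewrite -covP /cover -bigcup_seq; apply: eq_bigcupl.
  by split => i //= _; rewrite mem_index_enum.
rewrite /Rintegral -UP integral_bigsetU_EFin//.
- by rewrite -sum_fine// => i _; apply: integrable_fin_num => //;
    exact: integrableS intf.
- exact: index_enum_uniq.
- exact: sub_trivIset tP.
- by rewrite UP; case/integrableP: intf.
Qed.

Lemma sum_partition_measure : \sum_(i < n) fine (mu (P i)) = 1.
Proof.
transitivity (\int[mu]_x (1 : R)).
  rewrite Rintegral_partition; last exact: finite_measure_integrable_cst.
  by apply: eq_bigr => i _; rewrite Rintegral_cst// mul1r.
by rewrite Rintegral_cst// mul1r; exact: (congr1 fine (probability_setT mu)).
Qed.

(** Monotonicity on each piece against a constant. The [a i] are arbitrary, to serve both for infima
    over thickenings and for shifted tag values. *)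
Lemma Rintegral_partition_ge (f : T -> R) (a : 'I_n -> R) :
  mu.-integrable [set: T] (EFin \o f) ->
  (forall i x, P i x -> a i <= f x) ->
  \sum_(i < n) fine (mu (P i)) * a i <= \int[mu]_x f x.
Proof.
move=> intf af; rewrite Rintegral_partition//; apply: ler_sum => i _.
rewrite mulrC -Rintegral_cst//; apply: le_Rintegral => //.
- exact: finite_measure_integrable_cst.
- exact: integrableS intf.
- exact: af.
Qed.

Lemma Rintegral_partition_le (f : T -> R) (b : 'I_n -> R) :
  mu.-integrable [set: T] (EFin \o f) ->
  (forall i x, P i x -> f x <= b i) ->
  \int[mu]_x f x <= \sum_(i < n) fine (mu (P i)) * b i.
Proof.
move=> intf fb; rewrite Rintegral_partition//; apply: ler_sum => i _.
rewrite mulrC -Rintegral_cst//; apply: le_Rintegral => //.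
- exact: integrableS intf.
- exact: finite_measure_integrable_cst.
- exact: fb.
Qed.

End partition_integral.

(** * Splitting crescents into small ones, and Cousin's lemma *)

Section crescent_splitting.
Context {R : realType} {X : pointedMetricType R}.
Variable B : set (set X).
Hypotheses (compactX : compact [set: X]) (basisB : closed_basis B).
Hypothesis partB : partitionable (crescents B).
Implicit Types (C : set X) (Q : set (set X)) (D : set (set X)).

Lemma basis_crescent U : B U -> crescents B U.
Proof.
case: basisB => _ B0 _ _ BU; exists U => //; exists set0 => //.
by rewrite setC0 setIT.
Qed.

Lemma crescent_measurable C :
  crescents B C -> measurable (C : set (borelType X)).
Proof.
have mB U : B U -> measurable (U : set (borelType X)).
  by case: basisB => -[oB _] _ _ _ BU; apply: sub_sigma_algebra; exact: oB.
move=> [U /mB mU [V /mB mV <-]]; apply: measurableI => //.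
exact: measurableC.
Qed.

(** A set of pieces, with the empty piece allowed, instead of an indexed family: splittings can then
    be glued without reindexing. *)
Definition splits Q C := exists D : set (set X),
  [/\ finite_set D, D `<=` crescents B `&` Q, trivIset D id
    & C = \bigcup_(A in D) A].

Lemma splits0 Q : splits Q set0.
Proof. by exists set0; split => //; rewrite bigcup_set0. Qed.

Lemma splits1 Q C : crescents B C -> Q C -> splits Q C.
Proof.
move=> BC QC; exists [set C]; split => //.
- by move=> _ ->.
- by move=> A A' -> ->.
- by rewrite bigcup_set1.
Qed.

Lemma splits_bigcup Q D : finite_set D -> trivIset D id ->
  (forall A, D A -> splits Q A) -> splits Q (\bigcup_(A in D) A).
Proof.
move=> finD tD DQ.
have /choice[E EP] (A : set X) : exists E : set (set X), D A ->
    [/\ finite_set E, E `<=` crescents B `&` Q, trivIset E id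
      & A = \bigcup_(S in E) S].
  have [/DQ[E ?]|nDA] := pselect (D A); first by exists E.
  by exists set0.
have ES A S x : D A -> E A S -> S x -> A x.
  by move=> DA EAS Sx; have [_ _ _ ->] := EP A DA; exists S.
exists (\bigcup_(A in D) E A); split.
- by apply: bigcup_finite => // A /EP[].
- by move=> S [A /EP[_ + _ _]]; exact.
- move=> S S' [A DA EAS] [A' DA' EAS'] [x [Sx S'x]].
  (* Each piece lies in the member of [D] that it splits, so overlapping pieces come from the same
     member. *)
  have AA' : A = A'.
    by apply: tD => //; exists x; split; [exact: ES Sx|exact: ES S'x].
  subst A'; have [_ _ tE _] := EP A DA.
  by apply: tE => //; exists x.
- apply/seteqP; split => x [A].
  + move=> DA Ax; have [_ _ _ AE] := EP A DA.
    by move: Ax; rewrite /= {1}AE => -[S ES' Sx]; exists S => //; exists A.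
  + by move=> [A' DA' EA'] Ax; exists A' => //; exact: ES Ax.
Qed.

Lemma splits_setU Q C C' : C `&` C' = set0 ->
  splits Q C -> splits Q C' -> splits Q (C `|` C').
Proof.
move=> CC' QC QC'; rewrite -(bigcup_set1 id C) -(bigcup_set1 id C').
rewrite -bigcup_setU; apply: splits_bigcup.
- by rewrite finite_setU.
- move=> A A' /= [->|->] [->|->] //; rewrite ?(setIC C') CC'; by case.
- by move=> A /= [->|->].
Qed.

Lemma splits_crescent_partition Q C : splits Q C ->
  exists n (P : 'I_n -> set X), crescent_partition B C P /\ forall i, Q (P i).
Proof.
move=> [D [finD DQ tD CD]].
have [s Ds] : exists s : seq (set X), D `&` [set A | A !=set0] = [set` s].
  by apply/finite_seqP; exact: finite_setIl.
have sP A : A \in s -> D A /\ A !=set0.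
  by move=> ?; rewrite -[_ /\ _]/((_ `&` _) A) Ds.
(* Only non-empty pieces are listed, and [undup] makes the indexing injective, so that distinct
   indices give disjoint pieces. *)
pose P i := tnth (in_tuple (undup s)) i.
have PP i : D (P i) /\ P i !=set0.
  by apply: sP; rewrite -mem_undup; exact: mem_tnth.
exists (size (undup s)), P; split => [|i]; last by have [/DQ[]] := PP i.
split => [i|]; first by have [/DQ[]] := PP i.
split.
- rewrite CD; apply/seteqP; split => x.
    by move=> [i _ Pix]; exists (P i) => //; case: (PP i).
  move=> [A DA Ax].
  have : A \in s.
    by rewrite -[is_true _]/([set` s] A) -Ds; split => //; exists x.
  rewrite -mem_undup => /(tnthP (in_tuple (undup s)))[i Ai].
  by exists i => //; rewrite /P -Ai.
- move=> i j _ _ /tD PiPj.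
  have /eqP : P i = P j by apply: PiPj; [case: (PP i)|case: (PP j)].
  rewrite /P !(tnth_nth set0) nth_uniq//= ?undup_uniq//.
  by move/eqP/val_inj.
- by move=> i _; case: (PP i).
Qed.

(** Induction on the cover: the part of [C] in [U] is one crescent, and the rest is a finite
    disjoint union of crescents covered by the remaining sets. Recording that the pieces lie in [C]
    gives the nesting needed for Cousin's lemma. *)
Lemma splits_cover Q (s : seq (set X)) C : crescents B C ->
  (forall U, U \in s -> B U) ->
  (forall U A, U \in s -> A `<=` U -> Q A) ->
  C `<=` \bigcup_(U in [set` s]) U -> splits (Q `&` [set A | A `<=` C]) C.
Proof.
elim: s C => [|U s IH] C BC sB sQ Cs.
  rewrite (_ : C = set0); first exact: splits0.
  by apply/seteqP; split => // x /Cs[].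
have [BI BD] := partB.
have cU : crescents B U by apply/basis_crescent/sB; rewrite mem_head.
rewrite -[X in splits _ X](setUIDK C U); apply: splits_setU.
- by rewrite setIACA setICr setI0.
- apply: splits1; first exact: BI.
  by split => /=; [apply: (sQ U); rewrite ?mem_head//; exact: subIsetr|
    exact: subIsetl].
- have [D [finD DB DE tD]] := BD C U BC cU.
  rewrite DE; apply: splits_bigcup => // A DA.
  have AD : A `<=` C `\` U by rewrite DE => x Ax; exists A.
  have [||||E [finE EQ tE AE]] := IH A.
  + exact: DB.
  + by move=> V Vs; apply: sB; rewrite in_cons Vs orbT.
  + by move=> V A' Vs; apply: sQ; rewrite in_cons Vs orbT.
  + move=> x /AD[Cx nUx]; have [V] := Cs x Cx.
    by rewrite /= in_cons => /orP[/eqP->//|Vs Vx]; exists V.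
  exists E; split => // S /EQ[cS [QS SA]]; split => //; split => //.
  by move=> x /SA/AD[].
Qed.

(** Basic open sets of diameter below [delta] cover the space; a finite subcover feeds
    [splits_cover]. *)
Lemma splits_diam_lt C (delta : R) : crescents B C -> 0 < delta ->
  splits (diam_lt delta `&` [set A | A `<=` C]) C.
Proof.
move=> cC d0; have [[oB nB] _ _ _] := basisB.
move: compactX; rewrite compact_cover.
move=> /(_ _ (B `&` diam_lt delta) id)[|x _|F FD Fcov].
- by move=> U [/oB].
- have [|U [BU Ux] Ud] := nB x (ball x (delta / 2)).
    by apply: nbhsx_ballx; rewrite divr_gt0.
  exists U => //; split => // y z /Ud + /Ud; rewrite ballEmdist/= => xy xz.
  by have := metric_triangle y x z; rewrite (metric_sym y x); lra.
apply: (@splits_cover _ (finmap.enum_fset F)) => // [U /FD|U A /FD|x Cx].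
- by rewrite inE => -[].
- by rewrite inE => -[_ Ud AU]; exact: diam_lt_sub Ud.
- exact: Fcov.
Qed.

Lemma cousin (gamma : X -> R) : gauge gamma ->
  exists n (P : 'I_n -> set X) (t : 'I_n -> X),
    tagged_partition B P t /\ gauge_fine gamma P t.
Proof.
move=> gamma0.
(* The sets that a single tag makes fine. *)
pose Q : set (set X) :=
  [set A | exists t, closure A t /\
     closure A `<=` [set y | mdist t y < gamma t]].
suff /splits_crescent_partition[n [P [BP]]] : splits Q [set: X].
  by move=> /choice[t tP]; exists n, P, t; split => [|i]; [split => // i|];
    case: (tP i).
apply: contrapT => nQ.
pose bad C := crescents B C /\ ~ splits Q C.
(* [g] sends a stage and a bad crescent to a smaller bad crescent inside it; on other inputs its
   value is irrelevant. *)
have /choice[g gP] (p : nat * set X) : exists A, bad p.2 ->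
    [/\ bad A, A `<=` p.2 & diam_lt p.1.+1%:R^-1 A].
  have [[cC nC]|] := pselect (bad p.2); last by exists set0.
  have [|D [finD DP tD CD]] := @splits_diam_lt p.2 p.1.+1%:R^-1 cC.
    by rewrite invr_gt0.
  (* If every small piece could be split, gluing would split the whole bad crescent. *)
  suff [A DA nA] : exists2 A, D A & ~ splits Q A.
    by exists A => _; have [cA [dA AC]] := DP A DA.
  apply: contrapT => /forall2NP nD; apply: nC; rewrite CD.
  apply: splits_bigcup => // A DA.
  by have [//|/contrapT] := nD A.
pose c := fix c n := if n is m.+1 then g (m, c m) else [set: X].
have badc n : bad (c n).
  elim: n => [|n /(gP (n, _))[]//]; split => //.
  by apply: basis_crescent; case: basisB.
have cS n : c n.+1 `<=` c n by have [] := gP (n, c n) (badc n).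
have cd n : diam_lt n.+1%:R^-1 (c n.+1) by have [] := gP (n, c n) (badc n).
have cle m n : (m <= n)%N -> c n `<=` c m.
  elim: n => [|n IH]; first by rewrite leqn0 => /eqP->.
  rewrite leq_eqVlt ltnS => /predU1P[->//|/IH]; exact: subset_trans.
have /choice[u cu] n : exists x, c n x.
  apply: contrapT => /forallNP c0; have [_ []] := badc n.
  rewrite (_ : c n = set0); first exact: splits0.
  by apply/seteqP; split => // x /c0.
(* The common point of the closures is a cluster point of points chosen in the nested crescents. *)
have [p [_ up]] : [set: X] `&` cluster (u @ \oo) !=set0.
  by apply: compactX; exact: filterT.
have pc n : closure (c n) p.
  move=> U pU; have [|x []] := up (c n) U _ pU; last by exists x.
  by exists n => // m /= nm; exact: cle (cu m).
have [k] := ltr_add_invr (gamma0 p); rewrite add0r => kp.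
(* The crescent [c k.+1] is fine with tag [p], so it splits trivially as one piece. Closure weakens
   its diameter bound to a non-strict one, which the strict [kp] absorbs. *)
have [_ []] := badc k.+1; apply: splits1; first by case: (badc k.+1).
exists p; split => // y cy; apply: le_lt_trans kp.
exact: closure_diam_le (cd k) _ _.
Qed.

End crescent_splitting.

(** * The interval of the mixed combination and the tagged sums, compared with the Lebesgue
    integral *)

Section interval_integral.
Context {R : realType} {X : pointedMetricType R}.
Implicit Types (f : X -> R) (A : set X).

Lemma subset_thickening A (alpha : R) : 0 <= alpha ->
  A `<=` thickening (closure A) alpha.
Proof.
by move=> a0 x Ax; exists x; [exact: subset_closure|rewrite mdistxx].
Qed.

(** The bound [M] ensures that [inf] is a true lower bound and not a default value. *)
Lemma inf_image_le f M A x : (forall y, `|f y| <= M) -> A x ->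
  inf (f @` A) <= f x.
Proof.
move=> fM Ax; apply: ge_inf; last by exists x.
by exists (- M) => _ [y _ <-]; have := fM y; rewrite ler_norml => /andP[].
Qed.

Lemma sup_image_ge f M A x : (forall y, `|f y| <= M) -> A x ->
  f x <= sup (f @` A).
Proof.
move=> fM Ax; apply: ub_le_sup; last by exists x.
by exists M => _ [y _ <-]; have := fM y; rewrite ler_norml => /andP[].
Qed.

Lemma sup_inf_image_le f A e : A !=set0 ->
  (forall x y, A x -> A y -> f x - f y <= e) ->
  sup (f @` A) - inf (f @` A) <= e.
Proof.
move=> A0 fe; have fA0 : f @` A !=set0 by apply: image_nonempty.
rewrite lerBlDr; apply: ge_sup => // _ [x Ax <-].
rewrite -lerBlDl; apply: lb_le_inf => // _ [y Ay <-].
by have := fe _ _ Ax Ay; lra.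
Qed.

Lemma diam_itvcc (a b : R) : a <= b -> diam `[a, b] = b - a.
Proof.
move=> ab; have aa : `[a, b]%classic a by rewrite /= in_itv/= lexx.
have bb : `[a, b]%classic b by rewrite /= in_itv/= lexx andbT.
have ub : ubound [set `|x - y| | x in `[a, b] & y in `[a, b]] (b - a).
  move=> _ [x + [y + <-]]; rewrite /= !in_itv/= ler_norml => *; lra.
apply/eqP; rewrite eq_le; apply/andP; split.
  by apply: ge_sup => //; exists `|a - a|, a => //; exists a.
apply: ub_le_sup; first by exists (b - a).
(* The endpoints attain the bound. *)
by exists b => //; exists a => //; rewrite ger0_norm// subr_ge0.
Qed.

Variables (mu : probability (borelType X) R) (B : set (set X)).
Hypotheses (compactX : compact [set: X]) (basisB : closed_basis B).
Variables (f : X -> R) (n : nat) (P : 'I_n -> set X).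
Hypotheses (cf : continuous f) (crP : crescent_partition B [set: X] P).

Let mP i : measurable (P i : set (borelType X)).
Proof. by apply: (crescent_measurable basisB); case: crP. Qed.

Let partP : partition [set: 'I_n] P [set: borelType X].
Proof. by case: crP. Qed.

Let intf := continuous_integrable mu compactX cf.

Lemma lower_sum_mixed alpha beta :
  lower_sum f (mixed_partition_comb mu P alpha beta) =
  beta * inf (f @` [set: X]) + (1 - beta) *
    \sum_(i < n) fine (mu (P i)) * inf (f @` thickening (closure (P i)) alpha).
Proof.
rewrite /lower_sum big_cons big_map big_image/= mulr_sumr.
by congr (_ + _); apply: eq_bigr => i _; rewrite mulrA.
Qed.

Lemma upper_sum_mixed alpha beta :
  upper_sum f (mixed_partition_comb mu P alpha beta) =
  beta * sup (f @` [set: X]) + (1 - beta) *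
    \sum_(i < n) fine (mu (P i)) * sup (f @` thickening (closure (P i)) alpha).
Proof.
rewrite /upper_sum big_cons big_map big_image/= mulr_sumr.
by congr (_ + _); apply: eq_bigr => i _; rewrite mulrA.
Qed.

Lemma comb_integral_Rintegral (alpha beta : R) : 0 <= alpha -> 0 <= beta <= 1 ->
  comb_integral f (mixed_partition_comb mu P alpha beta) (\int[mu]_x f x).
Proof.
move=> a0 /andP[b0 b1]; have [M fM] := compact_bounded_image compactX cf.
have PT i x : P i x -> thickening (closure (P i)) alpha x.
  exact: subset_thickening.
have I1 (c : R) : \int[mu]_(_ in [set: borelType X]) c = c.
  by rewrite Rintegral_cst// (congr1 fine (probability_setT mu)) mulr1.
have intc c : mu.-integrable [set: borelType X] (EFin \o cst c).
  exact: finite_measure_integrable_cst.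
rewrite /comb_integral /= in_itv/= lower_sum_mixed upper_sum_mixed.
(* The integral is split in the ratio of the mixture: the first share is compared with constants on
   all of [X], the second piece by piece. *)
have -> : \int[mu]_x f x =
    beta * (\int[mu]_x f x) + (1 - beta) * (\int[mu]_x f x) by ring.
rewrite !lerD ?ler_wpM2l ?subr_ge0//.
- rewrite -[leRHS]I1; apply: le_Rintegral => // [|x _].
    exact: intc.
  exact: sup_image_ge.
- apply: Rintegral_partition_le => // i x /PT; exact: sup_image_ge.
- rewrite -[leLHS]I1; apply: le_Rintegral => // [|x _].
    exact: intc.
  exact: inf_image_le.
- apply: Rintegral_partition_ge => // i x /PT; exact: inf_image_le.
Qed.

(** The mass at [X] contributes the full oscillation of [f]; the rest is an average of local
    oscillations, with weights of sum 1. *)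
Lemma diam_comb_integral_le (alpha beta e : R) : 0 <= alpha -> 0 <= beta <= 1 ->
  (forall i x y, thickening (closure (P i)) alpha x ->
    thickening (closure (P i)) alpha y -> f x - f y <= e) ->
  diam (comb_integral f (mixed_partition_comb mu P alpha beta)) <=
  beta * (sup (f @` [set: X]) - inf (f @` [set: X])) + (1 - beta) * e.
Proof.
move=> a0 b01 fe; have /andP[b0 b1] := b01.
(* Containing the integral, the interval is non-empty, so its diameter is the difference of its
   endpoints. *)
have := comb_integral_Rintegral a0 b01.
rewrite /comb_integral /= in_itv => /andP[l u].
rewrite diam_itvcc; last exact: le_trans u.
rewrite lower_sum_mixed upper_sum_mixed.
rewrite opprD addrACA -mulrBr -mulrBr lerD2l ler_wpM2l ?subr_ge0//.
rewrite -sumrB -[e in leRHS]mul1r.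
rewrite -(sum_partition_measure mu mP partP) mulr_suml.
apply: ler_sum => i _; rewrite -mulrBr ler_wpM2l ?fine_ge0//.
apply: sup_inf_image_le (fe i).
have [_ _ /(_ i Logic.I)[x Px]] := partP.
by exists x; exact: subset_thickening.
Qed.

Lemma tagged_integral_near (t : 'I_n -> X) e :
  (forall i x, P i x -> `|f (t i) - f x| <= e) ->
  `|tagged_integral mu f P t - \int[mu]_x f x| <= e.
Proof.
move=> fe.
(* The weights sum to 1, so shifting all tag values by [c] shifts the sum by [c]. *)
have sumD c : \sum_(i < n) fine (mu (P i)) * (f (t i) + c) =
    tagged_integral mu f P t + c.
  under eq_bigr do rewrite mulrDr.
  rewrite big_split/= -mulr_suml sum_partition_measure// mul1r; congr (_ + _).
  by apply: eq_bigr => i _; rewrite mulrC.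
have := @Rintegral_partition_le _ _ _ mu _ _ mP partP f
  (fun i => f (t i) + e) intf.
have := @Rintegral_partition_ge _ _ _ mu _ _ mP partP f
  (fun i => f (t i) - e) intf.
rewrite !sumD ler_distl => h1 h2; apply/andP; split.
  have : \int[mu]_x f x <= tagged_integral mu f P t + e.
    by apply: h2 => i x /fe; rewrite ler_norml; lra.
  lra.
have : tagged_integral mu f P t - e <= \int[mu]_x f x.
  by apply: h1 => i x /fe; rewrite ler_norml; lra.
lra.
Qed.

End interval_integral.

Theorem theorem3p13 (R : realType) (X : pointedMetricType R)
    (compactX : compact [set: X])
    (mu : probability (borelType X) R)
    (B : set (set X)) (basisB : closed_basis B)
    (partB : partitionable (crescents B))
    (f : X -> R) (cf : continuous f) (r : R) :
  [<-> (\int[mu]_x (f x)%:E)%E = r%:E;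
       forall eps : R, 0 < eps ->
         exists (n : nat) (P : 'I_n -> set X) (alpha beta : R),
           [/\ crescent_partition B [set: X] P,
               0 < alpha < 1, 0 < beta < 1,
               comb_integral f (mixed_partition_comb mu P alpha beta) r &
               diam (comb_integral f (mixed_partition_comb mu P alpha beta))
                 < eps];
       forall eps : R, 0 < eps ->
         exists gamma : X -> R, gauge gamma /\
           forall (n : nat) (P : 'I_n -> set X) (t : 'I_n -> X),
             tagged_partition B P t -> gauge_fine gamma P t ->
             `|tagged_integral mu f P t - r| < eps].
Proof.
pose I := \int[mu]_x f x.
have intf := continuous_integrable mu compactX cf.
have intE : (\int[mu]_x (f x)%:E)%E = I%:E.
  by rewrite /I /Rintegral fineK//; exact: integrable_fin_num.
have [M fM] := compact_bounded_image compactX cf.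
tfae.
(* From (i) to (ii). *)
- rewrite intE => -[<-{r}] eps eps0.
  have [|delta delta0 fd] := @compact_oscillation _ _ f (eps / 2) compactX cf.
    by rewrite divr_gt0.
  pose W := sup (f @` [set: X]) - inf (f @` [set: X]).
  have W0 : 0 <= W.
    have := inf_image_le fM (Logic.I : [set: X] point).
    have := sup_image_ge fM (Logic.I : [set: X] point).
    by rewrite /W; lra.
  (* Two thickenings add at most [delta / 2] to a closure of diameter at most [delta / 4], which
     stays below [delta]; the [1 / 2] keeps [alpha] below 1. *)
  pose alpha := Num.min (delta / 4) (1 / 2).
  (* Chosen so that [beta * W] is below [eps / 2]; adding [eps] to [W] keeps the denominator
     positive when [f] is constant. *)
  pose beta := eps / (2 * (W + eps)).
  have [||n [P [crP dP]]] := splits_crescent_partition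
      (@splits_diam_lt _ _ B compactX basisB partB [set: X] (delta / 4) _ _).
  + by apply: basis_crescent => //; case: basisB.
  + by rewrite divr_gt0.
  have a0 : 0 < alpha by rewrite lt_min !divr_gt0.
  have a1 : alpha < 1 by rewrite gt_min; apply/orP; right; lra.
  have ad : alpha <= delta / 4 by rewrite ge_min lexx.
  have b0 : 0 < beta by rewrite divr_gt0// mulr_gt0//; lra.
  have bE : beta * (W + eps) = eps / 2.
    by rewrite /beta; field; apply: lt0r_neq0; lra.
  have b1 : beta < 1 by nra.
  exists n, P, alpha, beta; split; rewrite ?a0 ?b0//.
    by apply: (comb_integral_Rintegral mu compactX basisB cf crP);
      rewrite ?ltW// !ltW.
  apply: le_lt_trans (diam_comb_integral_le mu compactX basisB cf crP
    (e := eps / 2) (ltW a0) _ _) _; first by rewrite !ltW.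
    move=> i x y [x' Px' xx'] [y' Py' yy']; apply/ltW.
    apply: le_lt_trans (ler_norm _) _; apply: fd.
    have := closure_diam_le (proj1 (dP i)) Px' Py'.
    have := metric_triangle x x' y; have := metric_triangle x' y' y.
    rewrite (metric_sym y' y); lra.
  rewrite -/W; nra.
- move=> H2.
  (* From (ii) to (iii): [I] and [r] share intervals of arbitrarily small length, so they agree. *)
  have <- : I = r.
    apply/eqP; rewrite -subr_eq0 -normr_le0; apply/ler_addgt0Pr => eps eps0.
    have [n [P [a [b [crP /andP[a0 _] /andP[b0 b1] rI dI]]]]] := H2 eps eps0.
    have b01 : 0 <= b <= 1 by rewrite !ltW.
    have := comb_integral_Rintegral mu compactX basisB cf crP (ltW a0) b01.
    move: rI dI.
    rewrite -/I /comb_integral /= !in_itv/= => /andP[lr ru] + /andP[lI Iu].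
    rewrite diam_itvcc ?(le_trans lr)// add0r ler_norml; lra.
  move=> eps eps0.
  have [|delta delta0 fd] := @compact_oscillation _ _ f (eps / 2) compactX cf.
    by rewrite divr_gt0.
  (* A constant gauge suffices: fineness puts each piece within [delta] of its tag. *)
  exists (fun=> delta); split=> // n P t [crP _] fine_t.
  apply: le_lt_trans (tagged_integral_near mu compactX basisB cf crP
    (e := eps / 2) _) _; last lra.
  move=> i x Px; apply/ltW/fd; apply: fine_t; exact: subset_closure.
- move=> H3; rewrite intE; congr EFin.
  apply/eqP; rewrite -subr_eq0 -normr_le0; apply/ler_addgt0Pr => eps eps0.
  have e20 : 0 < eps / 2 by rewrite divr_gt0.
  have [gamma [gamma0 gP]] := H3 _ e20.
  have [delta delta0 fd] := compact_oscillation compactX cf e20.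
  (* From (iii) to (i): a partition fine for this minimum has its tagged sum close to [r] by (iii)
     and close to [I] by uniform continuity. Cousin's lemma supplies one. *)
  have min0 : gauge (fun x => Num.min (gamma x) delta).
    by move=> x; rewrite lt_min gamma0.
  have [n [P [t [tP fP]]]] := cousin compactX basisB partB min0.
  have tI : `|tagged_integral mu f P t - I| <= eps / 2.
    apply: (tagged_integral_near mu compactX basisB cf (proj1 tP)) => i x Px.
    apply/ltW/fd; have := fP i x (subset_closure Px).
    by rewrite /= lt_min => /andP[].
  have : `|tagged_integral mu f P t - r| < eps / 2.
    by apply: gP tP _ => i x /fP; rewrite /= lt_min => /andP[].
  by move: tI; rewrite add0r ltr_norml !ler_norml; lra.
Qed.
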